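(* The Lie algebra of the algebraic ind-group $\operatorname{Aut}_R(\mathbb{C}\overline{Q};c)$ is strictly smaller than the Lie algebra of symplectic derivations of $\mathbb{C}\overline{Q}$, i.e. there is an $R$-linear derivation $D$ of $\mathbb{C}\overline{Q}$ with $D(c)=0$ which does not belong to $\operatorname{Lie}\bigl(\operatorname{Aut}_R(\mathbb{C}\overline{Q};c)\bigr)$.
   Context: $Q$ is the quiver with vertices $1,2$ and arrows $a$ (a loop at $1$), $x$ (from $2$ to $1$), $y$ (from $1$ to $2$). Its double $\overline{Q}$ has in addition arrows $a^\ast,x^\ast,y^\ast$, where $z^\ast$ goes in the direction opposite to $z$. $\mathbb{C}\overline{Q}$ is the path algebra (paths written from right to left), with trivial paths $\pi_1,\pi_2$, and $R=\mathbb{C}\pi_1\oplus\mathbb{C}\pi_2$. Put $c=[a,a^\ast]+[x,x^\ast]+[y,y^\ast]$. $\operatorname{Aut}_R\mathbb{C}\overline{Q}$ is the group of algebra automorphisms fixing $R$ pointwise and $\operatorname{Aut}_R(\mathbb{C}\overline{Q};c)$ the subgroup of those fixing $c$. A symplectic derivation is a derivation $D$ of $\mathbb{C}\overline{Q}$ with $D|_R=0$ and $D(c)=0$. Ind-group structure: $\mathbb{C}\overline{Q}$ is filtered by path length, and $\operatorname{Aut}_R\mathbb{C}\overline{Q}$ is viewed as a closed subset of $(\mathbb{C}\overline{Q})^{\oplus 12}$ by sending $\phi$ to the values of $\phi$ and $\phi^{-1}$ on the six generators $a,a^\ast,x,x^\ast,y,y^\ast$; the elements for which these values have degree $\le n$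 form a (reduced) affine variety, and these varieties give an increasing filtration. $\operatorname{Aut}_R(\mathbb{C}\overline{Q};c)$ is a closed subgroup with the induced filtration. Its Lie algebra is the tangent space at the identity, i.e. the union of the Zariski tangent spaces at the identity of the varieties of this filtration; it is identified with a Lie subalgebra of the Lie algebra of symplectic derivations (a tangent vector determines a derivation through its values on the generators). *)

(* Defs.v *)
From HB Require Import structures.
From mathcomp Require Import all_boot all_order all_algebra.
From mathcomp Require Import finmap.
From mathcomp Require Import reals complex.
From mathcomp.multinomials Require Import monalg.

Set Implicit Arguments.
Unset Strict Implicit.
Unset Printing Implicit Defensive.

Import GRing.Theory.

Local Open Scope ring_scope.

(* The vertex set is required to be nonempty, so that path algebras are nonzero
   rings and hence belong to MathComp's hierarchy of algebras. *)
Record quiver := Quiver {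
  vertex : finType;
  arrow : finType;
  arrow_source : arrow -> vertex;
  arrow_target : arrow -> vertex;
  vertex_gt0 : (0 < #|vertex|)%N
}.

Section Paths.
Variable Q : quiver.

(* [path_from_to s l t]: the word l, written from right to left like a product
   of arrows, is a path from s to t. *)
Fixpoint path_from_to (s : vertex Q) (l : seq (arrow Q)) (t : vertex Q) : bool :=
  if l is e :: l' then (arrow_target e == t) && path_from_to s l' (arrow_source e) else s == t.

(* A path is the triple (source, word, target); the endpoints are kept since
   they are not determined by the empty word. *)
Record qpath := QPath {
  qpath_val : vertex Q * seq (arrow Q) * vertex Q;
  _ : path_from_to qpath_val.1.1 qpath_val.1.2 qpath_val.2
}.

HB.instance Definition _ := [isSub for qpath_val].
HB.instance Definition _ := [Choice of qpath by <:].

Definition psource (p : qpath) := (val p).1.1.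
Definition pword (p : qpath) := (val p).1.2.
Definition ptarget (p : qpath) := (val p).2.
Definition plength (p : qpath) := size (pword p).

Lemma qpathP (p : qpath) : path_from_to (psource p) (pword p) (ptarget p).
Proof. exact: (valP p). Qed.

Lemma triv_path_subproof (v : vertex Q) : path_from_to v [::] v.
Proof. exact: eqxx. Qed.

Definition triv_path (v : vertex Q) : qpath :=
  @QPath (v, [::], v) (triv_path_subproof v).

Lemma arrow_path_subproof (e : arrow Q) : path_from_to (arrow_source e) [:: e] (arrow_target e).
Proof. by rewrite /= !eqxx. Qed.

Definition arrow_path (e : arrow Q) : qpath :=
  @QPath (arrow_source e, [:: e], arrow_target e) (arrow_path_subproof e).

Lemma path_from_to_cat s l u l' t :
  path_from_to s l u -> path_from_to u l' t -> path_from_to s (l' ++ l) t.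
Proof.
by elim: l' t => [|e l' IH] t /=; [move=> h /eqP<- | move=> h /andP[-> /(IH _ h)]].
Qed.

(* [pcomp p q] is "p after q"; it is undefined when p does not start where q
   ends. *)
Definition pcomp (p q : qpath) : option qpath :=
  if psource p == ptarget q
  then insub (psource q, pword p ++ pword q, ptarget p) else None.

Lemma qpath_inj (p q : qpath) : psource p = psource q -> pword p = pword q ->
  ptarget p = ptarget q -> p = q.
Proof.
move=> hs hw ht; apply: val_inj; move: hs hw ht.
by rewrite /psource /pword /ptarget; case: (val p) (val q) => [[? ?] ?] [[? ?] ?] /= -> -> ->.
Qed.

Variant pcomp_spec (p q : qpath) : option qpath -> Prop :=
| PCompSome r of psource p = ptarget q & psource r = psource q
    & pword r = pword p ++ pword q & ptarget r = ptarget p : pcomp_spec p q (Some r)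
| PCompNone of psource p <> ptarget q : pcomp_spec p q None.

Lemma pcompP p q : pcomp_spec p q (pcomp p q).
Proof.
rewrite /pcomp; case: eqP => [h|]; last by constructor.
case: insubP => [r _ hr|/negP[]]; last first.
  by apply: path_from_to_cat (qpathP q) _; rewrite -h qpathP.
by constructor; rewrite // /psource /pword /ptarget hr.
Qed.

Lemma pcompA p q r :
  obind (pcomp p) (pcomp q r) = obind (fun pq => pcomp pq r) (pcomp p q).
Proof.
case: pcompP => [qr h1 s1 w1 t1|h1]; case: pcompP => [pq h2 s2 w2 t2|h2] //=.
- case: pcompP => [u h3 s3 w3 t3|[]]; last by rewrite h2 t1.
  case: pcompP => [v h4 s4 w4 t4|[]]; last by rewrite s2 h1.
  by congr Some; apply: qpath_inj; rewrite ?s3 ?s4 ?w3 ?w4 ?w1 ?w2 ?catA ?t3 ?t4.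
- by case: pcompP => // u h3; case: h2; rewrite h3 t1.
- by case: pcompP => // u h3; case: h1; rewrite -s2 h3.
Qed.

Lemma pcomp_trivl v p : pcomp (triv_path v) p = if v == ptarget p then Some p else None.
Proof.
case: pcompP => [r h s w t|/eqP/negbTE h]; rewrite -[v]/(psource (triv_path v)).
  by rewrite h eqxx; congr Some; apply: qpath_inj; rewrite ?t.
by rewrite h.
Qed.

Lemma pcomp_trivr v p : pcomp p (triv_path v) = if v == psource p then Some p else None.
Proof.
case: pcompP => [r h s w t|/eqP/negbTE h]; rewrite -[v]/(ptarget (triv_path v)).
  rewrite h eqxx; congr Some; apply: qpath_inj => //; first by rewrite s h.
  by rewrite w cats0.
by rewrite eq_sym h.
Qed.

End Paths.

Definition path_algebra (F : fieldType) (Q : quiver) : Type := {malg F[qpath Q]}.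

HB.instance Definition _ (F : fieldType) (Q : quiver) :=
  GRing.Zmodule.on (path_algebra F Q).

(* Scaling and the constants below are locked because unification otherwise
   unfolds them down to finite maps and does not return. *)
HB.lock Definition pa_scale (F : fieldType) (Q : quiver) (c : F) (u : path_algebra F Q) :
    path_algebra F Q := c *: (u : {malg F[qpath Q]}).

Section PathAlgebraScale.
Variables (F : fieldType) (Q : quiver).
Local Notation A := (path_algebra F Q).
Implicit Types (c d : F) (u v : A).

Lemma pa_scalerA c d u : pa_scale c (pa_scale d u) = pa_scale (c * d) u.
Proof. by rewrite pa_scale.unlock; apply: scalerA. Qed.

Lemma pa_scale1r : left_id 1 (@pa_scale F Q).
Proof. by move=> u; rewrite pa_scale.unlock; apply: scale1r. Qed.

Lemma pa_scalerDr : right_distributive (@pa_scale F Q) +%R.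
Proof. by move=> c u v; rewrite pa_scale.unlock; apply: scalerDr. Qed.

Lemma pa_scalerDl v : {morph (@pa_scale F Q)^~ v : c d / c + d}.
Proof. by move=> c d; rewrite pa_scale.unlock; apply: scalerDl. Qed.

HB.instance Definition _ := GRing.Zmodule_isLmodule.Build F A
  pa_scalerA pa_scale1r pa_scalerDr pa_scalerDl.

Lemma mcoeff_pa_scale c u p : mcoeff p (c *: u) = c * mcoeff p u.
Proof. by rewrite [c *: u]/GRing.scale /= pa_scale.unlock; apply: mcoeffZ. Qed.

Lemma msupp_pa_scale c u : (msupp (c *: u) `<=` msupp u)%fset.
Proof. by rewrite [c *: u]/GRing.scale /= pa_scale.unlock; apply: msuppZ_le. Qed.

End PathAlgebraScale.

HB.lock Definition path_elt (F : fieldType) (Q : quiver) (p : qpath Q) : path_algebra F Q :=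
  << 1 *g p >>.

HB.lock Definition path_coeff (F : fieldType) (Q : quiver) (p : qpath Q)
    (u : path_algebra F Q) : F := mcoeff p u.

HB.lock Definition path_mul (F : fieldType) (Q : quiver) (p q : qpath Q) : path_algebra F Q :=
  oapp (@path_elt F Q) 0 (pcomp p q).

HB.lock Definition pa_mul (F : fieldType) (Q : quiver) (u v : path_algebra F Q) :
    path_algebra F Q :=
  \sum_(p <- msupp u) \sum_(q <- msupp v)
     (path_coeff p u * path_coeff q v) *: path_mul F p q.

Section PathAlgebra.
Variables (F : fieldType) (Q : quiver).
Local Notation A := (path_algebra F Q).
Local Notation path_elt := (@path_elt F Q).
Local Notation path_mul := (@path_mul F Q).

Implicit Types (u v w : A) (p q r : qpath Q).

Lemma pa_mulw (d1 d2 : {fset qpath Q}) u v :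
  (msupp u `<=` d1)%fset -> (msupp v `<=` d2)%fset ->
  pa_mul u v = \sum_(p <- d1) \sum_(q <- d2)
     (path_coeff p u * path_coeff q v) *: path_mul p q.
Proof.
move=> le1 le2; rewrite pa_mul.unlock (big_fset_incl _ le1) /=.
  apply/eq_bigr=> p _; apply/big_fset_incl => // q _ /mcoeff_outdom.
  by rewrite path_coeff.unlock => ->; rewrite mulr0 scale0r.
move=> p _ /mcoeff_outdom hp.
by rewrite big1 // => q _; rewrite path_coeff.unlock hp mul0r scale0r.
Qed.

Lemma pa_mulDl : left_distributive (@pa_mul F Q) +%R.
Proof.
move=> u v w.
rewrite (pa_mulw (msuppD_le u v) (fsubset_refl _)).
rewrite (pa_mulw (fsubsetUl _ (msupp v)) (fsubset_refl (msupp w))).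
rewrite (pa_mulw (fsubsetUr (msupp u) _) (fsubset_refl (msupp w))).
rewrite -big_split; apply/eq_bigr=> p _; rewrite -big_split; apply/eq_bigr=> q _.
by rewrite path_coeff.unlock mcoeffD mulrDl scalerDl.
Qed.

Lemma pa_mulDr : right_distributive (@pa_mul F Q) +%R.
Proof.
move=> w u v.
rewrite (pa_mulw (fsubset_refl _) (msuppD_le u v)).
rewrite (pa_mulw (fsubset_refl (msupp w)) (fsubsetUl _ (msupp v))).
rewrite (pa_mulw (fsubset_refl (msupp w)) (fsubsetUr (msupp u) _)).
rewrite -big_split; apply/eq_bigr=> p _; rewrite -big_split; apply/eq_bigr=> q _.
by rewrite path_coeff.unlock mcoeffD mulrDr scalerDl.
Qed.

Lemma pa_mulZl c u v : pa_mul (c *: u) v = c *: pa_mul u v.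
Proof.
rewrite (pa_mulw (msupp_pa_scale c u) (fsubset_refl _)) pa_mul.unlock scaler_sumr.
apply/eq_bigr=> p _; rewrite scaler_sumr; apply/eq_bigr=> q _.
by rewrite path_coeff.unlock mcoeff_pa_scale -mulrA scalerA.
Qed.

Lemma pa_mulZr c u v : pa_mul u (c *: v) = c *: pa_mul u v.
Proof.
rewrite (pa_mulw (fsubset_refl _) (msupp_pa_scale c v)) pa_mul.unlock scaler_sumr.
apply/eq_bigr=> p _; rewrite scaler_sumr; apply/eq_bigr=> q _.
by rewrite path_coeff.unlock mcoeff_pa_scale mulrCA scalerA.
Qed.

Lemma pa_mul0l : left_zero 0 (@pa_mul F Q).
Proof. by move=> u; have := pa_mulZl 0 0 u; rewrite !scale0r. Qed.

Lemma pa_mul0r : right_zero 0 (@pa_mul F Q).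
Proof. by move=> u; have := pa_mulZr 0 u 0; rewrite !scale0r. Qed.

Lemma pa_mulE p q : pa_mul (path_elt p) (path_elt q) = path_mul p q.
Proof.
rewrite path_elt.unlock.
rewrite (pa_mulw msuppU_le msuppU_le) !big_seq_fset1 path_coeff.unlock !mcoeffUU.
by rewrite mulr1 scale1r.
Qed.

Lemma path_coeff_elt p q : path_coeff q (path_elt p) = (p == q)%:R.
Proof. by rewrite path_coeff.unlock path_elt.unlock; apply: mcoeffU. Qed.

Lemma path_eltE u : u = \sum_(p <- msupp u) path_coeff p u *: path_elt p.
Proof.
rewrite [LHS]monalgE; apply/eq_bigr=> p _; apply/malgP=> q.
apply: etrans (mcoeffU _ _ _) _; apply: esym; apply: etrans (mcoeff_pa_scale _ _ _) _.
rewrite path_elt.unlock path_coeff.unlock; apply: etrans (congr1 _ (mcoeffU _ _ _)) _.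
by case: (p == q); rewrite ?mulr1n ?mulr0n ?mulr1 ?mulr0.
Qed.

Lemma path_algebra_ind (P : A -> Prop) :
  P 0 -> (forall u v, P u -> P v -> P (u + v)) ->
  (forall c p, P (c *: path_elt p)) -> forall u, P u.
Proof.
move=> P0 PD PE u; rewrite (path_eltE u).
by elim/big_ind: _ => // p _; apply: PE.
Qed.

Lemma pa_mulA : associative (@pa_mul F Q).
Proof.
move=> u v w; elim/path_algebra_ind: u => [|u u' IH IH'|c p].
- by rewrite !pa_mul0l.
- by rewrite !pa_mulDl IH IH'.
elim/path_algebra_ind: v => [|v v' IH IH'|d q].
- by rewrite pa_mul0r !pa_mul0l pa_mul0r.
- by rewrite pa_mulDr !pa_mulDl pa_mulDr IH IH'.
elim/path_algebra_ind: w => [|w w' IH IH'|e r].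
- by move: (c *: _) (d *: _) => x y; rewrite !pa_mul0r.
- by move: (c *: _) (d *: _) IH IH' => x y IH IH'; rewrite !pa_mulDr IH IH'.
rewrite !(pa_mulZl c); congr (_ *: _).
rewrite pa_mulZl !pa_mulZr pa_mulZl; rewrite [RHS]scalerA [LHS]scalerA mulrC.
congr (_ *: _).
rewrite !pa_mulE path_mul.unlock; have := pcompA p q r.
case: (pcomp q r) => [qr|]; case: (pcomp p q) => [pq|] /=;
  rewrite ?pa_mul0l ?pa_mul0r ?pa_mulE ?path_mul.unlock //; by [move=> -> | move=> <-].
Qed.

Definition pa_one : A := \sum_v path_elt (triv_path v).

Lemma pa_mul1l : left_id pa_one (@pa_mul F Q).
Proof.
move=> u; elim/path_algebra_ind: u => [|u u' IH IH'|c p]; first exact: pa_mul0r.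
  by rewrite pa_mulDr IH IH'.
rewrite pa_mulZr; congr (_ *: _).
rewrite /pa_one (big_morph (fun x => pa_mul x _) (fun _ _ => pa_mulDl _ _ _) (pa_mul0l _)).
rewrite (bigD1 (ptarget p)) //= big1 ?addr0 => [|v /negbTE hv];
  by rewrite pa_mulE path_mul.unlock pcomp_trivl ?eqxx ?hv.
Qed.

Lemma pa_mul1r : right_id pa_one (@pa_mul F Q).
Proof.
move=> u; elim/path_algebra_ind: u => [|u u' IH IH'|c p]; first exact: pa_mul0l.
  by rewrite pa_mulDl IH IH'.
rewrite pa_mulZl; congr (_ *: _).
rewrite /pa_one (big_morph (pa_mul _) (fun _ _ => pa_mulDr _ _ _) (pa_mul0r _)).
rewrite (bigD1 (psource p)) //= big1 ?addr0 => [|v /negbTE hv];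
  by rewrite pa_mulE path_mul.unlock pcomp_trivr ?eqxx ?hv.
Qed.

Lemma pa_one_neq0 : pa_one != 0.
Proof.
have [v _] : exists v : vertex Q, v \in vertex Q by apply/card_gt0P/vertex_gt0.
apply/eqP=> h; have := path_coeff_elt (triv_path v) (triv_path v).
rewrite eqxx -[path_elt _]pa_mul1l h pa_mul0l path_coeff.unlock mcoeff0.
by move=> /esym/eqP; rewrite oner_eq0.
Qed.

HB.instance Definition _ := GRing.Zmodule_isNzRing.Build A
  pa_mulA pa_mul1l pa_mul1r pa_mulDl pa_mulDr pa_one_neq0.

HB.instance Definition _ := GRing.Lmodule_isLalgebra.Build F A
  (fun c u v => esym (pa_mulZl c u v)).

HB.instance Definition _ := GRing.Lalgebra_isAlgebra.Build F A
  (fun c u v => esym (pa_mulZr c u v)).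

Definition vertex_elt (v : vertex Q) : A := path_elt (triv_path v).

Definition arrow_elt (e : arrow Q) : A := path_elt (arrow_path e).

Definition degree_le (n : nat) (u : A) : Prop :=
  forall p, path_coeff p u != 0 -> (plength p <= n)%N.

Definition pa_commutator (u v : A) : A := u * v - v * u.

End PathAlgebra.

(* [inl e] is the arrow e of Q and [inr e] is the reversed arrow e^*. *)
Definition double_quiver (Q : quiver) : quiver :=
  @Quiver (vertex Q) (arrow Q + arrow Q)%type
    (fun e => match e with inl e => arrow_source e | inr e => arrow_target e end)
    (fun e => match e with inl e => arrow_target e | inr e => arrow_source e end)
    (vertex_gt0 Q).

(* Imported only here because many of its names are also used by monalg. *)
From mathcomp.multinomials Require Import mpoly.

Section IndGroup.
Variables (F : fieldType) (Q : quiver).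
Local Notation A := (path_algebra F (double_quiver Q)).

Definition symplectic_elt : A :=
  \sum_(e : arrow Q)
     pa_commutator (arrow_elt F (inl e : arrow (double_quiver Q)))
                   (arrow_elt F (inr e : arrow (double_quiver Q))).

(* The pair (phi, psi) consists of an element of Aut_R(C Qbar; c) and its
   inverse.  Fixing the trivial paths is the same as fixing R pointwise, as phi is
   linear. *)
Definition is_symplectic_aut (phi psi : {lrmorphism A -> A}) : Prop :=
  [/\ cancel phi psi, cancel psi phi,
      forall v, phi (vertex_elt F v) = vertex_elt F v
    & phi symplectic_elt = symplectic_elt].

(* A point of A^(2g), g being the number of generators: the component [inl e] is
   meant for the value of an automorphism on e, and [inr e] for that of its
   inverse. *)
Definition gen_point : Type :=
  arrow (double_quiver Q) + arrow (double_quiver Q) -> A.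

Definition aut_point (phi psi : A -> A) : gen_point := fun k =>
  match k with
  | inl e => phi (arrow_elt F e)
  | inr e => psi (arrow_elt F e)
  end.

(* The n-th variety of the filtration of Aut_R(C Qbar; c). *)
Definition aut_filtration (n : nat) (P : gen_point) : Prop :=
  exists phi psi : {lrmorphism A -> A},
    [/\ is_symplectic_aut phi psi, P =1 aut_point phi psi
      & forall k, degree_le n (P k)].

(* The coordinate functions of the space of points are indexed by a component
   and a path; a regular function is a polynomial in finitely many of them. *)
Definition coord_index : Type :=
  (arrow (double_quiver Q) + arrow (double_quiver Q)) * qpath (double_quiver Q).

Definition coords (N : nat) (x : 'I_N -> coord_index) (P : gen_point) : 'I_N -> F :=
  fun i => path_coeff (x i).2 (P (x i).1).

(* The Zariski tangent space at P of X with its reduced structure: the vectors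
   killed by the differentials at P of all the regular functions vanishing on X.
   When X consists of points of degree at most n, so do its tangent vectors,
   since the coordinate functions at longer paths vanish on X. *)
Definition zariski_tangent (X : gen_point -> Prop) (P T : gen_point) : Prop :=
  X P /\
  forall (N : nat) (x : 'I_N -> coord_index) (f : mpoly N F),
    (forall P', X P' -> f.@[coords x P'] = 0) ->
    \sum_(i < N) (f^`M(i)).@[coords x P] * coords x T i = 0.

Definition is_derivation (D : {linear A -> A}) : Prop :=
  forall u v, D (u * v) = D u * v + u * D v.

Definition is_R_derivation (D : {linear A -> A}) : Prop :=
  is_derivation D /\ forall v, D (vertex_elt F v) = 0.

Definition is_symplectic_derivation (D : {linear A -> A}) : Prop :=
  is_R_derivation D /\ D symplectic_elt = 0.

(* The Lie algebra of Aut_R(C Qbar; c): the derivations whose values on the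
   generators are those of some tangent vector at the identity. *)
Definition in_Lie_aut (D : {linear A -> A}) : Prop :=
  is_R_derivation D /\
  exists (n : nat) (T : gen_point),
    zariski_tangent (aut_filtration n) (aut_point id id) T /\
    forall e, D (arrow_elt F e) = T (inl e).

End IndGroup.

Inductive Qvertex := vertex1 | vertex2.
Inductive Qarrow := arrow_a | arrow_x | arrow_y.

Definition Qvertex_code (v : Qvertex) : 'I_2 :=
  match v with vertex1 => inord 0 | vertex2 => inord 1 end.
Definition Qvertex_decode (i : 'I_2) : Qvertex :=
  match val i with 0%N => vertex1 | _ => vertex2 end.
Lemma Qvertex_codeK : cancel Qvertex_code Qvertex_decode.
Proof. by case; rewrite /Qvertex_decode /= inordK. Qed.
HB.instance Definition _ := Finite.copy Qvertex (can_type Qvertex_codeK).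

Definition Qarrow_code (e : Qarrow) : 'I_3 :=
  match e with arrow_a => inord 0 | arrow_x => inord 1 | arrow_y => inord 2 end.
Definition Qarrow_decode (i : 'I_3) : Qarrow :=
  match val i with 0%N => arrow_a | 1%N => arrow_x | _ => arrow_y end.
Lemma Qarrow_codeK : cancel Qarrow_code Qarrow_decode.
Proof. by case; rewrite /Qarrow_decode /= inordK. Qed.
HB.instance Definition _ := Finite.copy Qarrow (can_type Qarrow_codeK).

Lemma Qvertex_gt0 : (0 < #|{: Qvertex}|)%N.
Proof. by apply/card_gt0P; exists vertex1. Qed.

Definition quiver_axy : quiver :=
  @Quiver Qvertex Qarrow
    (fun e => match e with arrow_a => vertex1 | arrow_x => vertex2 | arrow_y => vertex1 end)
    (fun e => match e with arrow_a => vertex1 | arrow_x => vertex1 | arrow_y => vertex2 end)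
    Qvertex_gt0.

(* Main.v *)
(* Modulo the paths of length at least 2 in x, x^*, y, y^*, a symplectic
   automorphism phi sends x and y^* to left combinations of x and y^* with
   coefficients in C<a, a^*>. Evaluating a at s and a^* at 0 gives a 2 x 2 matrix
   over C[s], which is invertible because phi is; hence its determinant is constant,
   and the coefficient at s of this determinant is a quadratic regular function that
   vanishes on the whole group. Its differential at the identity is the coefficient
   at s of the trace, and takes the value 1 on the Hamiltonian derivation
   x |-> a x, x^* |-> - x^* a, a^* |-> - x x^* of the cyclic word x^* a x. *)

Require Import Defs.
From HB Require Import structures.
From mathcomp Require Import all_boot all_order all_algebra.
From mathcomp Require Import reals complex.
From mathcomp Require Import finmap ring.
From mathcomp.multinomials Require Import mpoly.

Set Implicit Arguments.
Unset Strict Implicit.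
Unset Printing Implicit Defensive.

Import GRing.Theory.
Local Open Scope ring_scope.

(** * Coefficients in a path algebra and the formula for those of a product *)

Section Coefficients.
Variables (F : fieldType) (Q : quiver).
Local Notation A := (path_algebra F Q).
Implicit Types (u v w : A) (p q r : qpath Q).

Lemma path_coeffD p u v : path_coeff p (u + v) = path_coeff p u + path_coeff p v.
Proof. by rewrite path_coeff.unlock monalg.mcoeffD. Qed.

Lemma path_coeffZ p c u : path_coeff p (c *: u) = c * path_coeff p u.
Proof. by rewrite path_coeff.unlock mcoeff_pa_scale. Qed.

Lemma path_coeff0 p : path_coeff p (0 : A) = 0.
Proof. by rewrite path_coeff.unlock monalg.mcoeff0. Qed.

Lemma path_coeffN p u : path_coeff p (- u) = - path_coeff p u.
Proof. by rewrite -scaleN1r path_coeffZ mulN1r. Qed.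

Lemma path_coeffB p u v : path_coeff p (u - v) = path_coeff p u - path_coeff p v.
Proof. by rewrite path_coeffD path_coeffN. Qed.

Lemma path_coeff_sum p (I : Type) (s : seq I) (G : I -> A) :
  path_coeff p (\sum_(i <- s) G i) = \sum_(i <- s) path_coeff p (G i).
Proof. exact: (big_morph _ (path_coeffD p) (path_coeff0 p)). Qed.

Lemma path_coeff_inj u v : (forall p, path_coeff p u = path_coeff p v) -> u = v.
Proof. by rewrite path_coeff.unlock => h; apply/monalg.malgP. Qed.

Lemma path_elt_mul p q :
  path_elt F p * path_elt F q = oapp (@path_elt F Q) 0 (Defs.pcomp p q).
Proof. by apply: etrans (pa_mulE F p q) _; rewrite path_mul.unlock. Qed.

(** The leftmost arrow of a nonempty word fixes the target and the rightmost one fixes the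
    source. *)
Lemma qpath_eq_word p q : pword p = pword q -> pword p != [::] -> p = q.
Proof.
move=> hw hn; have hp := qpathP p; have := qpathP q; move: hp.
case Ep: (pword p) hn => [//|e l] _; rewrite -hw Ep => hp hq.
have src s s' (t t' : vertex Q) e' l' :
    path_from_to s (e' :: l') t -> path_from_to s' (e' :: l') t' -> (s = s') * (t = t').
  elim: l' e' t t' => [|e2 l2 IH] e' t t' /=.
    by move=> /andP[/eqP<- /eqP->] /andP[/eqP<- /eqP->].
  move=> /andP[/eqP<- h] /andP[/eqP<- h'].
  by split=> //; have [-> _] := IH _ _ _ h h'.
by have [h1 h2] := src _ _ _ _ _ _ hp hq; apply: qpath_inj.
Qed.

Lemma path_coeff_word (r p : qpath Q) : pword r != [::] ->
  path_coeff r (path_elt F p) = (pword p == pword r)%:R.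
Proof.
move=> rn; rewrite path_coeff_elt; congr (_%:R); congr nat_of_bool.
apply/eqP/eqP => [->//|h]; apply: qpath_eq_word => //.
by rewrite h.
Qed.

Lemma qpath_ind (P : qpath Q -> Prop) :
  (forall v : vertex Q, P (triv_path v)) ->
  (forall e p q, pword p = e :: pword q -> ptarget q = arrow_source e ->
     path_elt F p = arrow_elt F e * path_elt F q -> P q -> P p) ->
  forall p, P p.
Proof.
move=> Pv Pe [[[s w] t] hp]; elim: w t hp => [|e l IH] t hp.
  have st : s = t by apply/eqP.
  by rewrite (_ : QPath hp = triv_path s) //; apply: qpath_inj.
have /andP[/eqP ht hl] := hp; apply: Pe (IH _ hl) => //.
rewrite path_elt_mul; case: pcompP => [r _ h2 h3 h4 /=|[]//].
by congr path_elt; apply: qpath_inj; rewrite ?h2 ?h3 ?h4 //= -ht.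
Qed.

(** Paths are built by adding arrows on the left of a trivial path, and they span. The case of 0
    comes from scaling a vertex element by 0. *)
Lemma path_algebra_gen_ind (P : A -> Prop) :
  (forall u v, P u -> P v -> P (u + v)) -> (forall c u, P u -> P (c *: u)) ->
  (forall v : vertex Q, P (vertex_elt F v)) -> (forall e u, P u -> P (arrow_elt F e * u)) ->
  forall u, P u.
Proof.
move=> PD PZ Pv Pe.
have Pp p : P (path_elt F p).
  elim/qpath_ind: p => [v|e p q _ _ ->]; [exact: Pv | exact: Pe].
apply: path_algebra_ind => //; last by move=> c p; apply: PZ.
have [v _] : exists v : vertex Q, v \in vertex Q by apply/card_gt0P/vertex_gt0.
by rewrite -(scale0r (vertex_elt F v)); apply: PZ.
Qed.

(* A valid word determines the intermediate vertex of each of its cuts, except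
   for the empty suffix, whose vertex is the source. *)
Definition cut_vertex (s : vertex Q) (l : seq (arrow Q)) : vertex Q :=
  if l is e :: _ then arrow_target e else s.

Lemma path_from_to_cut s l1 l2 t : path_from_to s (l1 ++ l2) t ->
  path_from_to (cut_vertex s l2) l1 t && path_from_to s l2 (cut_vertex s l2).
Proof.
elim: l1 t => [|e l1 IH] t /=; last by move=> /andP[-> /IH].
by case: l2 => [|e l2] /= => [/eqP->|/andP[/eqP-> ->]]; rewrite !eqxx.
Qed.

(** Both triples are genuine paths, as [path_cutP] shows, so [insubd] returns them and not its
    default [r]. *)
Definition path_cut r (i : nat) : qpath Q * qpath Q :=
  let m := cut_vertex (psource r) (drop i (pword r)) in
  (insubd r (m, take i (pword r), ptarget r), insubd r (psource r, drop i (pword r), m)).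

Lemma path_cutP r i :
  [/\ Defs.pcomp (path_cut r i).1 (path_cut r i).2 = Some r,
      pword (path_cut r i).1 = take i (pword r)
    & pword (path_cut r i).2 = drop i (pword r)].
Proof.
rewrite /path_cut /=; set m := cut_vertex _ _.
have /andP[h1 h2] : path_from_to m (take i (pword r)) (ptarget r) &&
    path_from_to (psource r) (drop i (pword r)) m.
  by apply: path_from_to_cut; rewrite cat_take_drop qpathP.
have v1 : val (insubd r (m, take i (pword r), ptarget r)) = (m, take i (pword r), ptarget r).
  by rewrite val_insubd h1.
have v2 : val (insubd r (psource r, drop i (pword r), m)) = (psource r, drop i (pword r), m).
  by rewrite val_insubd h2.
have w1 := congr1 (fun x => x.1.2) v1; have w2 := congr1 (fun x => x.1.2) v2.
split; [|exact: w1|exact: w2].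
case: pcompP => [r' h s w t|[]]; last by rewrite /psource v1 /ptarget v2.
congr Some; apply: qpath_inj; rewrite ?s ?w ?t /psource /ptarget /pword ?v1 ?v2 //=.
by rewrite cat_take_drop.
Qed.

(** The length of the left factor fixes both words; the middle vertex is then forced by the source
    and the word of the right factor. *)
Lemma pcomp_cut p q r : Defs.pcomp p q = Some r -> (p, q) = path_cut r (plength p).
Proof.
case: pcompP => // r' h s w t [<-{r}].
have [] := path_cutP r' (plength p); rewrite /path_cut /=.
set p' := insubd _ _; set q' := insubd _ _.
case: pcompP => // r2 h' s' w' t' [?]; subst r2.
rewrite w /plength take_size_cat // drop_size_cat // => hp hq.
have eq_q : q' = q.
  apply: qpath_inj; rewrite // -?s -?s' //.
  have := qpathP q; have := qpathP q'; rewrite -s' s hq.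
  by case: (pword q) => [|e l] /= => [/eqP<- /eqP<-|/andP[/eqP<- _] /andP[/eqP<- _]].
by rewrite eq_q; congr (_, _); apply: qpath_inj; rewrite ?h ?h' ?eq_q -?t ?t' ?hp.
Qed.

Lemma path_cut_eq p q r i : (i <= plength r)%N ->
  (p == (path_cut r i).1) && (q == (path_cut r i).2) =
  (Defs.pcomp p q == Some r) && (i == plength p).
Proof.
move=> hi; apply/idP/idP => [/andP[/eqP-> /eqP->]|/andP[/eqP/pcomp_cut h /eqP->]].
  have := path_cutP r i; case: path_cut => p' q' /= [-> w _]; rewrite /= eqxx /=.
  by rewrite /plength w size_takel.
by rewrite -h /= !eqxx.
Qed.

(** By bilinearity it suffices to multiply two paths: if they compose to [r], they form exactly one
    cut of [r], otherwise none. A path of length n has n + 1 cuts, both ends included. *)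
Lemma path_coeffM r u v : path_coeff r (u * v) =
  \sum_(i < (plength r).+1)
     path_coeff (path_cut r i).1 u * path_coeff (path_cut r i).2 v.
Proof.
elim/path_algebra_ind: u => [|u u' IH IH'|c p].
- by rewrite mul0r path_coeff0 big1 // => i _; rewrite path_coeff0 mul0r.
- rewrite mulrDl path_coeffD IH IH' -big_split; apply: eq_bigr => i _.
  by rewrite path_coeffD mulrDl.
elim/path_algebra_ind: v => [|v v' IH IH'|d q].
- by rewrite mulr0 path_coeff0 big1 // => i _; rewrite path_coeff0 mulr0.
- rewrite mulrDr path_coeffD IH IH' -big_split; apply: eq_bigr => i _.
  by rewrite (path_coeffD _ v) mulrDr.
transitivity (c * d * path_coeff r (path_elt F p * path_elt F q)).
  by rewrite -scalerAl -scalerAr scalerA path_coeffZ.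
transitivity (\sum_(i < (plength r).+1)
    c * d * ((Defs.pcomp p q == Some r) && (i == plength p :> nat))%:R); last first.
  apply: eq_bigr => i _; have hi : (i <= plength r)%N by rewrite -ltnS.
  rewrite -(path_cut_eq p q hi) (path_coeffZ _ c) (path_coeffZ _ d) !path_coeff_elt.
  by rewrite -mulnb natrM mulrACA.
rewrite -mulr_sumr path_elt_mul; congr (_ * _).
case: (eqVneq (Defs.pcomp p q) (Some r)) => [Epq|hne]; last first.
  rewrite big1 //; case: (Defs.pcomp p q) hne => [r'|] /= hne; last exact: path_coeff0.
  by rewrite path_coeff_elt; have /negbTE-> : r' != r by apply: contraNneq hne => ->.
rewrite Epq /= path_coeff_elt eqxx.
have hp : (plength p < (plength r).+1)%N.
  by case: pcompP Epq => // r' _ _ w _ [<-]; rewrite /plength w size_cat ltnS leq_addr.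
rewrite (bigD1 (Ordinal hp)) //= eqxx big1 ?addr0 // => i.
by rewrite -val_eqE /= => /negbTE ->.
Qed.

End Coefficients.

(** * The derivative of a polynomial at a point along a vector *)

Section DirectionalDerivative.
Variables (F : fieldType) (N : nat) (v t : 'I_N -> F).

Definition dirderiv (f : {mpoly F[N]}) : F := \sum_(i < N) (f^`M(i)).@[v] * t i.

Lemma dirderivD f g : dirderiv (f + g) = dirderiv f + dirderiv g.
Proof.
by rewrite /dirderiv -big_split; apply: eq_bigr => i _; rewrite mderivD mevalD mulrDl.
Qed.

Lemma dirderivC c : dirderiv c%:MP = 0.
Proof. by rewrite /dirderiv big1 // => i _; rewrite mderivC meval0 mul0r. Qed.

Lemma dirderiv_sum (I : Type) (s : seq I) (G : I -> {mpoly F[N]}) :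
  dirderiv (\sum_(k <- s) G k) = \sum_(k <- s) dirderiv (G k).
Proof. by apply: (big_morph _ dirderivD); rewrite -mpolyC0 dirderivC. Qed.

Lemma dirderivM f g : dirderiv (f * g) = dirderiv f * g.@[v] + f.@[v] * dirderiv g.
Proof.
rewrite /dirderiv mulr_suml mulr_sumr -big_split; apply: eq_bigr => i _.
by rewrite mderivM mevalD !mevalM mulrDl mulrAC mulrA.
Qed.

Lemma dirderivX j : dirderiv 'X_j = t j.
Proof.
rewrite /dirderiv (bigD1 j) //= big1 ?addr0 => [|i ne].
  by rewrite mderivX mnm1E eqxx scale1r -[X in (X - _)%MM]add0m addmK mpolyX0 meval1 mul1r.
by rewrite mderivX mnm1E eq_sym (negbTE ne) scale0r meval0 mul0r.
Qed.

End DirectionalDerivative.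

(** * Linear conditions on tangent vectors coming from quadratic equations *)

Section Tangent.
Variables (F : fieldType) (Q : quiver).

Definition gen_coord (k : coord_index Q) (P : gen_point F Q) : F := path_coeff k.2 (P k.1).

(** The tangent condition is applied to the polynomial [f] of the quadratic equation; the Leibniz
    rule gives its differential. Both halves of the theorem use this form. *)
Lemma zariski_tangent_quadratic (X : gen_point F Q -> Prop) (P T : gen_point F Q)
    (I : finType) (c : I -> F) (x y : I -> coord_index Q) (c0 : F) :
  zariski_tangent X P T ->
  (forall P', X P' -> \sum_k c k * (gen_coord (x k) P' * gen_coord (y k) P') = c0) ->
  \sum_k c k * (gen_coord (x k) T * gen_coord (y k) P + gen_coord (x k) P * gen_coord (y k) T) = 0.
Proof.
case=> _ tanT eqX.
(* Every summand gets two variables of its own; several variables may stand for the same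
   coordinate. *)
pose z (i : 'I_#|{: I + I}|) := match enum_val i with inl k => x k | inr k => y k end.
pose Xl (k : I) : {mpoly F[#|{: I + I}|]} := 'X_(enum_rank (inl k : I + I)).
pose Xr (k : I) : {mpoly F[#|{: I + I}|]} := 'X_(enum_rank (inr k : I + I)).
pose f := \sum_k (c k)%:MP * (Xl k * Xr k) - c0%:MP.
have evl P' k : (Xl k).@[coords z P'] = gen_coord (x k) P'.
  by rewrite mevalXU /coords /z enum_rankK.
have evr P' k : (Xr k).@[coords z P'] = gen_coord (y k) P'.
  by rewrite mevalXU /coords /z enum_rankK.
have f0 P' : X P' -> f.@[coords z P'] = 0.
  move=> XP'; rewrite /f mevalB mevalC; apply/eqP; rewrite subr_eq0; apply/eqP.
  rewrite -(eqX _ XP') (big_morph _ (mevalD _) (meval0 _)); apply: eq_bigr => k _.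
  by rewrite !mevalM mevalC evl evr.
have := tanT _ z f f0; rewrite -/(dirderiv _ _ _) /f -mpolyCN dirderivD dirderivC addr0.
rewrite dirderiv_sum => e0; rewrite -[RHS]e0; apply: eq_bigr => k _.
rewrite !dirderivM dirderivC mul0r add0r mevalC evl evr !dirderivX.
by rewrite /coords /z !enum_rankK.
Qed.

End Tangent.

(** * The Lie algebra of the group consists of symplectic derivations *)

Section SymplecticTangent.
Variables (F : fieldType) (Q : quiver).
Local Notation Q2 := (double_quiver Q).
Local Notation A := (path_algebra F Q2).

(** The bilinear polarization of c: for [U = V] it is c with every arrow replaced by its value under
    [U]. *)
Definition commutator_pairing (U V : arrow Q2 -> A) : A :=
  \sum_(e : arrow Q) (U (inl e) * V (inr e) - U (inr e) * V (inl e)).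

Definition flip_arrow (b : bool) (e : arrow Q) : arrow Q2 := if b then inr e else inl e.

(** Flattened to one signed sum of products of two coordinates, the shape that
    [zariski_tangent_quadratic] expects. The boolean tells whether the left factor belongs to a
    reversed arrow. *)
Lemma path_coeff_commutator_pairing r U V :
  path_coeff r (commutator_pairing U V) =
  \sum_(k : arrow Q * bool * 'I_(plength r).+1)
     (-1) ^+ k.1.2 * (path_coeff (path_cut r k.2).1 (U (flip_arrow k.1.2 k.1.1)) *
                      path_coeff (path_cut r k.2).2 (V (flip_arrow (~~ k.1.2) k.1.1))).
Proof.
rewrite -(pair_bigA _ (fun (j : arrow Q * bool) (i : 'I_(plength r).+1) =>
  (-1) ^+ j.2 * (path_coeff (path_cut r i).1 (U (flip_arrow j.2 j.1)) *
                 path_coeff (path_cut r i).2 (V (flip_arrow (~~ j.2) j.1))))) /=.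
rewrite -(pair_bigA _ (fun (e : arrow Q) (b : bool) => \sum_(i < (plength r).+1)
  (-1) ^+ b * (path_coeff (path_cut r i).1 (U (flip_arrow b e)) *
               path_coeff (path_cut r i).2 (V (flip_arrow (~~ b) e))))) /=.
rewrite path_coeff_sum; apply: eq_bigr => e _.
rewrite big_bool -!mulr_sumr -!path_coeffM /= expr0 expr1 mul1r mulN1r addrC.
by rewrite path_coeffB.
Qed.

Lemma rmorph_symplectic_elt (phi : {lrmorphism A -> A}) :
  phi (symplectic_elt F Q) =
  commutator_pairing (phi \o @arrow_elt F Q2) (phi \o @arrow_elt F Q2).
Proof. by rewrite rmorph_sum; apply: eq_bigr => e _; rewrite rmorphB !rmorphM. Qed.

Lemma derivation_symplectic_elt (D : {linear A -> A}) : is_derivation D ->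
  D (symplectic_elt F Q) =
  commutator_pairing (D \o @arrow_elt F Q2) (@arrow_elt F Q2) +
  commutator_pairing (@arrow_elt F Q2) (D \o @arrow_elt F Q2).
Proof.
move=> derD; rewrite linear_sum /commutator_pairing -big_split; apply: eq_bigr => e _.
by rewrite linearB !derD /= opprD addrACA.
Qed.

(** Each coefficient of the equation phi(c) = c is quadratic in the coordinates of phi. Its
    differential at the identity is the same coefficient of D(c) = 0. *)
Lemma in_Lie_aut_symplectic (D : {linear A -> A}) :
  in_Lie_aut D -> is_symplectic_derivation D.
Proof.
case=> RD [n [T [tanT DT]]]; split=> //; have [derD _] := RD.
rewrite derivation_symplectic_elt //; apply: path_coeff_inj => r.
rewrite path_coeff0.
pose x (k : arrow Q * bool * 'I_(plength r).+1) : coord_index Q :=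
  (inl (flip_arrow k.1.2 k.1.1), (path_cut r k.2).1).
pose y (k : arrow Q * bool * 'I_(plength r).+1) : coord_index Q :=
  (inl (flip_arrow (~~ k.1.2) k.1.1), (path_cut r k.2).2).
have := zariski_tangent_quadratic
  (c := fun k : arrow Q * bool * 'I_(plength r).+1 => (-1) ^+ k.1.2 : F) (x := x) (y := y)
  (c0 := path_coeff r (symplectic_elt F Q)) tanT.
move=> <-; last first.
  move=> P' [phi [psi [[_ _ _ phic] eqP' _]]].
  rewrite -phic rmorph_symplectic_elt path_coeff_commutator_pairing.
  by apply: eq_bigr => k _; rewrite /gen_coord /x /y !eqP'.
rewrite path_coeffD !path_coeff_commutator_pairing -big_split /=; apply: eq_bigr => k _.
by rewrite -mulrDr /gen_coord /x /y /= !DT.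
Qed.

End SymplecticTangent.

(** * Evaluation of path algebra elements in a ring with orthogonal idempotents *)

Section UniversalProperty.
Variables (F : fieldType) (Q : quiver) (B : nzRingType).
Local Notation A := (path_algebra F Q).
Variables (j : {rmorphism F -> B}) (ev : vertex Q -> B) (ea : arrow Q -> B).

(** The final idempotent gives trivial paths their value; in a nonempty path the last arrow absorbs
    it. *)
Definition path_val (p : qpath Q) : B := (\prod_(e <- pword p) ea e) * ev (psource p).

Definition path_algebra_eval (u : A) : B :=
  \sum_(p <- monalg.msupp u) j (path_coeff p u) * path_val p.

Hypothesis j_central : forall c b, j c * b = b * j c.
Hypothesis ev_orth : forall v w, ev v * ev w = if v == w then ev v else 0.
Hypothesis ev_sum : \sum_v ev v = 1.
Hypothesis ea_source : forall e, ea e * ev (arrow_source e) = ea e.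
Hypothesis ea_target : forall e, ev (arrow_target e) * ea e = ea e.

Lemma path_algebra_eval_widen (d : {fset qpath Q}) u :
  (monalg.msupp u `<=` d)%fset ->
  path_algebra_eval u = \sum_(p <- d) j (path_coeff p u) * path_val p.
Proof.
move=> le; rewrite /path_algebra_eval (big_fset_incl _ le) //.
by move=> p _ /monalg.mcoeff_outdom; rewrite path_coeff.unlock => ->; rewrite rmorph0 mul0r.
Qed.

Lemma path_algebra_evalD u v :
  path_algebra_eval (u + v) = path_algebra_eval u + path_algebra_eval v.
Proof.
rewrite (path_algebra_eval_widen (monalg.msuppD_le u v)).
rewrite (path_algebra_eval_widen (fsubsetUl (monalg.msupp u) (monalg.msupp v))).
rewrite (path_algebra_eval_widen (fsubsetUr (monalg.msupp u) (monalg.msupp v))).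
rewrite -big_split; apply: eq_bigr => p _.
by rewrite path_coeffD rmorphD mulrDl.
Qed.

Lemma path_algebra_evalZ c u : path_algebra_eval (c *: u) = j c * path_algebra_eval u.
Proof.
rewrite (path_algebra_eval_widen (msupp_pa_scale c u)) mulr_sumr; apply: eq_bigr => p _.
by rewrite path_coeffZ rmorphM mulrA.
Qed.

Lemma path_algebra_eval_elt p : path_algebra_eval (path_elt F p) = path_val p.
Proof.
have le : (monalg.msupp (path_elt F p) `<=` [fset p])%fset.
  by rewrite path_elt.unlock; apply: monalg.msuppU_le.
by rewrite (path_algebra_eval_widen le) big_seq_fset1 path_coeff_elt eqxx rmorph1 mul1r.
Qed.

(** The leftmost arrow absorbs the idempotent of its target, so orthogonality decides. This makes
    the values of non-composable paths multiply to 0. *)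
Lemma path_val_target p v : ev v * path_val p = if v == ptarget p then path_val p else 0.
Proof.
rewrite /path_val; have := qpathP p; case: (pword p) => [|e l] /=.
  by rewrite big_nil mul1r ev_orth => /eqP<-; case: eqP => // ->.
move=> /andP[/eqP<- _]; rewrite big_cons -[ea e]ea_target !mulrA ev_orth.
by case: ifP => [/eqP->|]; rewrite ?mul0r.
Qed.

Lemma path_algebra_evalM u v :
  path_algebra_eval (u * v) = path_algebra_eval u * path_algebra_eval v.
Proof.
have e0 : path_algebra_eval 0 = 0.
  by rewrite -(scale0r (0 : A)) path_algebra_evalZ rmorph0 mul0r.
elim/path_algebra_ind: u => [|u u' IH IH'|c p].
- by rewrite mul0r e0 mul0r.
- by rewrite mulrDl !path_algebra_evalD mulrDl IH IH'.
elim/path_algebra_ind: v => [|v v' IH IH'|d q].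
- by rewrite mulr0 e0 mulr0.
- by rewrite mulrDr (path_algebra_evalD v) mulrDr -IH -IH' path_algebra_evalD.
rewrite -scalerAl -scalerAr !path_algebra_evalZ path_elt_mul !path_algebra_eval_elt.
have -> : j c * path_val p * (j d * path_val q) = j c * (j d * (path_val p * path_val q)).
  by rewrite -mulrA (mulrA (path_val p)) -j_central -!mulrA.
congr (_ * (_ * _)); case: pcompP => [r h s w t|/eqP/negbTE h] /=.
  rewrite path_algebra_eval_elt {1}/path_val s w big_cat /= -mulrA -/(path_val q).
  by rewrite /path_val -mulrA -/(path_val q) path_val_target h eqxx.
by rewrite /path_val -mulrA -/(path_val q) path_val_target h mulr0 e0.
Qed.

Lemma path_algebra_eval_vertex v : path_algebra_eval (vertex_elt F v) = ev v.
Proof. by rewrite path_algebra_eval_elt /path_val /= big_nil mul1r. Qed.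

Lemma path_algebra_eval_arrow e : path_algebra_eval (arrow_elt F e) = ea e.
Proof. by rewrite path_algebra_eval_elt /path_val /= big_seq1 ea_source. Qed.

Lemma path_algebra_eval1 : path_algebra_eval 1 = 1.
Proof.
have e0 : path_algebra_eval 0 = 0.
  by rewrite -(scale0r (0 : A)) path_algebra_evalZ rmorph0 mul0r.
rewrite -ev_sum (big_morph _ path_algebra_evalD e0); apply: eq_bigr => v _.
exact: path_algebra_eval_vertex.
Qed.

End UniversalProperty.

(** * Morphisms and derivations with prescribed values on the generators *)

Section Extension.
Variables (F : fieldType) (Q : quiver).
Local Notation A := (path_algebra F Q).

(** The scalars enter through a central morphism [j], which suits both later targets: matrices over
    the path algebra itself and matrices over polynomials. *)
Lemma path_algebra_rmorphism (B : nzRingType) (j : {rmorphism F -> B})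
    (ev : vertex Q -> B) (ea : arrow Q -> B) :
  (forall c b, j c * b = b * j c) ->
  (forall v w, ev v * ev w = if v == w then ev v else 0) ->
  \sum_v ev v = 1 ->
  (forall e, ea e * ev (arrow_source e) = ea e) ->
  (forall e, ev (arrow_target e) * ea e = ea e) ->
  exists f : {rmorphism A -> B},
    [/\ forall c u, f (c *: u) = j c * f u, forall v, f (vertex_elt F v) = ev v
      & forall e, f (arrow_elt F e) = ea e].
Proof.
move=> jC evM ev1 eas eat; pose f := path_algebra_eval j ev ea.
have f_zmod : {morph f : u v / u - v}.
  move=> u v; rewrite -scaleN1r /f path_algebra_evalD path_algebra_evalZ.
  by rewrite rmorphN1 mulN1r.
have f_mon : GRing.monoid_morphism f.
  by split; [apply: path_algebra_eval1 | apply: path_algebra_evalM].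
pose fm : {rmorphism A -> B} := HB.pack f (GRing.isZmodMorphism.Build _ _ f f_zmod)
  (GRing.isMonoidMorphism.Build _ _ f f_mon).
exists fm; split=> [c u|v|e]; first exact: path_algebra_evalZ.
  exact: path_algebra_eval_vertex.
exact: path_algebra_eval_arrow.
Qed.

Section UpperTriangular.
Variable R : nzRingType.
Definition upper2 (a b : R) : 'M[R]_2 :=
  \matrix_(i < 2, k < 2) (if i == k then a else if (i < k)%N then b else 0).

Lemma upper2M a b c d : upper2 a b * upper2 c d = upper2 (a * c) (a * d + b * c).
Proof.
apply/matrixP=> i k; rewrite !mxE !big_ord_recl big_ord0 !mxE /=.
by case: i k => [[|[|]]] // ? [[|[|]]] //= ?; rewrite ?mulr0 ?mul0r ?addr0 ?add0r.
Qed.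

Lemma upper2D a b c d : upper2 a b + upper2 c d = upper2 (a + c) (b + d).
Proof.
apply/matrixP=> i k; rewrite !mxE.
by case: i k => [[|[|]]] // ? [[|[|]]] //= ?; rewrite ?addr0.
Qed.

Lemma upper2_scalar a : a%:M = upper2 a 0.
Proof.
apply/matrixP=> i k; rewrite !mxE.
by case: i k => [[|[|]]] // ? [[|[|]]].
Qed.

Lemma upper2_01 a b : upper2 a b 0 1 = b.
Proof. by rewrite mxE. Qed.

End UpperTriangular.

Lemma vertex_elt_mul (v w : vertex Q) :
  vertex_elt F v * vertex_elt F w = if v == w then vertex_elt F v else 0.
Proof. by rewrite path_elt_mul pcomp_trivl; case: eqP => [->|]. Qed.

Lemma arrow_elt_source (e : arrow Q) :
  arrow_elt F e * vertex_elt F (arrow_source e) = arrow_elt F e.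
Proof. by rewrite path_elt_mul pcomp_trivr eqxx. Qed.

Lemma arrow_elt_target (e : arrow Q) :
  vertex_elt F (arrow_target e) * arrow_elt F e = arrow_elt F e.
Proof. by rewrite path_elt_mul pcomp_trivl eqxx. Qed.

Lemma sum_vertex_elt : \sum_v vertex_elt F v = 1 :> A.
Proof. by []. Qed.

(* A derivation D is the same as the algebra morphism u |-> (u, D u; 0, u). *)
Lemma path_algebra_derivation (d : arrow Q -> A) :
  (forall e, d e * vertex_elt F (arrow_source e) = d e) ->
  (forall e, vertex_elt F (arrow_target e) * d e = d e) ->
  exists D : {linear A -> A},
    [/\ forall u v, D (u * v) = D u * v + u * D v, forall v, D (vertex_elt F v) = 0
      & forall e, D (arrow_elt F e) = d e].
Proof.
move=> ds dt; pose j : {rmorphism F -> 'M[A]_2} := @scalar_mx A 2 \o in_alg A.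
have jE c : j c = upper2 (c%:A) 0 by rewrite /= -upper2_scalar.
have [c b|v w||e|e|f [fZ fv fe]] := @path_algebra_rmorphism 'M[A]_2 j
    (fun v => upper2 (vertex_elt F v) 0) (fun e => upper2 (arrow_elt F e) (d e)).
(* Although A is not commutative, [c%:A] is central in it, so its scalar matrix is central among the
   matrices. *)
- have cA (u : A) : c%:A * u = u * c%:A by rewrite mulr_algl mulr_algr.
  apply/matrixP=> i k; rewrite jE !mxE !big_ord_recl !big_ord0 !mxE /=.
  by case: i k => [[|[|]]] // ? [[|[|]]] //= ?;
    rewrite ?mul0r ?mulr0 ?addr0 ?add0r cA; congr (b _ _ * _); apply: val_inj.
- rewrite upper2M mulr0 mul0r addr0 vertex_elt_mul; case: eqP => // _.
  by rewrite -upper2_scalar raddf0.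
- under eq_bigr do rewrite -upper2_scalar.
  by rewrite -(raddf_sum (@scalar_mx A 2)) sum_vertex_elt.
- by rewrite upper2M mulr0 add0r arrow_elt_source ds.
- by rewrite upper2M mul0r addr0 arrow_elt_target dt.
pose D u := f u 0 1.
(* Matrices of the form [upper2 u (D u)] persist under the operations that generate A.
   Multiplicativity of [f] then becomes the Leibniz rule for [D]. *)
have fE u : f u = upper2 u (D u).
  elim/path_algebra_gen_ind: u => [u v hu hv|c u hu|v|e u hu].
  - by rewrite /D rmorphD hu hv upper2D upper2_01.
  - by rewrite /D fZ hu jE upper2M upper2_01 mul0r addr0 mulr_algl.
  - by rewrite /D fv upper2_01.
  by rewrite /D rmorphM fe hu upper2M upper2_01.
have D_lin : linear D.
  move=> c u v; rewrite {1}/D rmorphD fZ !fE jE upper2M upper2D upper2_01.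
  by rewrite mul0r addr0 mulr_algl.
pose Dl : {linear A -> A} := HB.pack D (GRing.isLinear.Build F A A *:%R D D_lin).
exists Dl; split=> [u v|v|e] /=.
- by rewrite /D rmorphM !fE upper2M !upper2_01 addrC.
- by rewrite /D fv upper2_01.
by rewrite /D fe upper2_01.
Qed.

End Extension.

(** * The given quiver: a Hamiltonian derivation and the determinant that obstructs it *)

Section QuiverAXY.
Variable F : fieldType.
Local Notation Q2 := (double_quiver quiver_axy).
Local Notation A := (path_algebra F Q2).
Local Notation a := (arrow_elt F (inl arrow_a : arrow Q2)).
Local Notation x := (arrow_elt F (inl arrow_x : arrow Q2)).
Local Notation x' := (arrow_elt F (inr arrow_x : arrow Q2)).
Local Notation y' := (arrow_elt F (inr arrow_y : arrow Q2)).
Local Notation pi1 := (vertex_elt F (vertex1 : vertex Q2)).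
Local Notation pi2 := (vertex_elt F (vertex2 : vertex Q2)).

Lemma big_Qvertex (V : nmodType) (G : Qvertex -> V) : \sum_v G v = G vertex1 + G vertex2.
Proof.
rewrite (bigD1 vertex1) //= (bigD1 vertex2) //=; last by apply/eqP.
by rewrite big1 ?addr0 // => -[]; rewrite eqxx ?andbF.
Qed.

Lemma big_Qarrow (V : nmodType) (G : Qarrow -> V) :
  \sum_e G e = G arrow_a + G arrow_x + G arrow_y.
Proof.
rewrite (bigD1 arrow_a) //= (bigD1 arrow_x) /=; last by apply/eqP.
rewrite (bigD1 arrow_y) /=; last by apply/andP; split; apply/eqP.
by rewrite big1 ?addr0 ?addrA // => -[]; rewrite eqxx ?andbF.
Qed.

Definition hamiltonian_values (e : arrow Q2) : A :=
  match e with
  | inl arrow_x => a * x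
  | inr arrow_x => - (x' * a)
  | inr arrow_a => - (x * x')
  | _ => 0
  end.

(* The Hamiltonian derivation of the cyclic word x^* a x. *)
Lemma hamiltonian_derivation_exists : exists D : {linear A -> A},
  is_symplectic_derivation D /\ forall e, D (arrow_elt F e) = hamiltonian_values e.
Proof.
have src := arrow_elt_source F (Q := Q2); have tgt := arrow_elt_target F (Q := Q2).
(* The bullets check that each nonzero value has the source and the target of its arrow. *)
have [[[]|[]]|[[]|[]]|D [DM Dv De]] := @path_algebra_derivation F Q2 hamiltonian_values;
  rewrite /hamiltonian_values ?mul0r ?mulr0 ?mulNr ?mulrN //.
- by rewrite -mulrA (src (inl arrow_x)).
- by rewrite -mulrA (src (inr arrow_x)).
- by rewrite -mulrA (src (inl arrow_a)).
- by rewrite mulrA (tgt (inl arrow_a)).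
- by rewrite mulrA (tgt (inl arrow_x)).
- by rewrite mulrA (tgt (inr arrow_x)).
exists D; split=> //; split; first by split.
(* The two terms for x add up to the commutator of a with x x^*, which cancels the term for a. *)
rewrite derivation_symplectic_elt // /commutator_pairing !big_Qarrow /= !De /hamiltonian_values.
rewrite !(mul0r, mulr0, mulNr, mulrN, opprK, subr0, sub0r, add0r, addr0) !mulrA.
by rewrite -!opprD addrCA subrr.
Qed.

Local Notation M3 := 'M[{poly F}]_3.

(* One dimension at vertex 1, two at vertex 2, over C[s]: x and y^* are the two
   basis covectors, so that first rows of images record left C[s]-coordinates. *)
Definition rep_vertex (v : Qvertex) : M3 :=
  if v is vertex1 then delta_mx 0 0 else delta_mx 1 1 + delta_mx 2 2.

(** Sending a^*, x^* and y to 0 leaves, besides the trivial paths, only powers of a and their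
    products with a final x or y^* on the right. *)
Definition rep_arrow (e : arrow Q2) : M3 :=
  match e with
  | inl arrow_a => 'X *: delta_mx 0 0
  | inl arrow_x => delta_mx 0 1
  | inr arrow_y => delta_mx 0 2
  | _ => 0
  end.

Lemma rep_exists : exists rho : {rmorphism A -> M3},
  [/\ forall c u, rho (c *: u) = c%:P%:M * rho u,
      forall v, rho (vertex_elt F (v : vertex Q2)) = rep_vertex v
    & forall e, rho (arrow_elt F e) = rep_arrow e].
Proof.
pose j : {rmorphism F -> M3} := @scalar_mx {poly F} 3 \o polyC.
have [|||||rho [rZ rv re]] := @path_algebra_rmorphism F Q2 M3 j rep_vertex rep_arrow;
  last by exists rho.
- by move=> c b; exact/esym/scalar_mxC.
- by case=> -[]; case: eqP => // _;
    rewrite -mulmxE /rep_vertex ?(mulmxDl, mulmxDr) ?mul_delta_mx_cond /=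
      ?mulr0n ?mulr1n ?addr0 ?add0r.
- rewrite big_Qvertex; apply/matrixP=> i k; rewrite !mxE.
  by case: i k => [[|[|[|]]]] // ? [[|[|[|]]]] //= ?; rewrite ?addr0 ?add0r.
- by case=> -[]; rewrite -mulmxE /rep_vertex /= ?mulmxDr -?scalemxAl ?mul0mx
    ?mul_delta_mx_cond /= ?mulr0n ?mulr1n ?addr0 ?add0r ?scaler0.
by case=> -[]; rewrite -mulmxE /rep_vertex /= ?mulmxDl -?scalemxAr ?mulmx0
    ?mul_delta_mx_cond /= ?mulr0n ?mulr1n ?addr0 ?add0r ?scaler0.
Qed.

Lemma mulmx3E (R : nzRingType) (M N : 'M[R]_3) i k :
  (M * N) i k = M i 0 * N 0 k + M i 1 * N 1 k + M i 2 * N 2 k.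
Proof.
rewrite mxE !big_ord_recl big_ord0 addr0 addrA.
by congr (_ * _ + M i _ * N _ _ + M i _ * N _ _); apply: val_inj.
Qed.

Lemma path_ax_subproof : @path_from_to Q2 vertex2 [:: inl arrow_a; inl arrow_x] vertex1.
Proof. by rewrite /= !eqxx. Qed.

Definition path_ax : qpath Q2 :=
  @QPath Q2 (vertex2 : vertex Q2, [:: inl arrow_a; inl arrow_x], vertex1 : vertex Q2)
    path_ax_subproof.

Lemma path_ay'_subproof : @path_from_to Q2 vertex2 [:: inl arrow_a; inr arrow_y] vertex1.
Proof. by rewrite /= !eqxx. Qed.

Definition path_ay' : qpath Q2 :=
  @QPath Q2 (vertex2 : vertex Q2, [:: inl arrow_a; inr arrow_y], vertex1 : vertex Q2)
    path_ay'_subproof.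

Local Notation path_x := (arrow_path (inl arrow_x : arrow Q2)).
Local Notation path_y' := (arrow_path (inr arrow_y : arrow Q2)).

Section Representation.
Variable rho : {rmorphism A -> M3}.
Hypothesis rhoZ : forall c u, rho (c *: u) = c%:P%:M * rho u.
Hypothesis rho_vertex : forall v, rho (vertex_elt F (v : vertex Q2)) = rep_vertex v.
Hypothesis rho_arrow : forall e, rho (arrow_elt F e) = rep_arrow e.

(** Left multiplication by a multiplies row 0 by ['X], while x and y^* move row 1 or row 2 to row 0.
    The lower block is therefore carried along in the induction. *)
Lemma rep_path (p : qpath Q2) (M := rho (path_elt F p)) :
  [/\ M 1 1 = ((pword p == [::]) && (ptarget p == vertex2))%:R,
      M 2 2 = ((pword p == [::]) && (ptarget p == vertex2))%:R,
      M 1 2 = 0 & M 2 1 = 0] /\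
  [/\ (M 0 1)`_0 = (pword p == [:: inl arrow_x])%:R,
      (M 0 1)`_1 = (pword p == [:: inl arrow_a; inl arrow_x])%:R,
      (M 0 2)`_0 = (pword p == [:: inr arrow_y])%:R
    & (M 0 2)`_1 = (pword p == [:: inl arrow_a; inr arrow_y])%:R].
Proof.
rewrite {}/M; elim/(@qpath_ind F): p => [v|e p q pe qe -> [[q11 q22 q12 q21] [q1 q1' q2 q2']]].
  rewrite [rho _]rho_vertex; case: v; rewrite !mxE /= ?addr0 ?add0r ?coef0.
    by have -> : (vertex1 == vertex2) = false by apply/eqP.
  by rewrite eqxx.
rewrite rmorphM rho_arrow !mulmx3E pe q11 q22 q12 q21.
case: e pe qe => -[] pe qe; rewrite !mxE /= ?(mul0r, mulr0, addr0, add0r, mulr1, mul1r, coef0).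
- split=> //; rewrite !coefXM /= q1 q2 !(eqseq_cons (inl arrow_a)) eqxx /=.
  by split=> //; case: eqP.
- split=> //; rewrite qe eqxx andbT !coefMn !coef1 /= mul0rn.
  by split=> //; [case: eqP => [->|ne]; case: eqP => // -[] | case: eqP | case: eqP].
- by split=> //; split=> //; case: eqP.
- by split=> //; split=> //; case: eqP.
- by split=> //; split=> //; case: eqP.
split=> //; rewrite qe eqxx andbT !coefMn !coef1 /= mul0rn.
by split=> //; case: eqP => [->|ne]; case: eqP => // -[].
Qed.

(** This turns the matrix entries, modulo ['X^2], into coordinate functions, so that the coefficient
    of the determinant is a regular function. *)
Lemma rep_coef u :
  [/\ (rho u 0 1)`_0 = path_coeff path_x u, (rho u 0 1)`_1 = path_coeff path_ax u,
      (rho u 0 2)`_0 = path_coeff path_y' u & (rho u 0 2)`_1 = path_coeff path_ay' u].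
Proof.
elim/path_algebra_ind: u => [|u v [u1 u2 u3 u4] [v1 v2 v3 v4]|c p].
- by rewrite rmorph0 !mxE !coef0 !path_coeff0.
- by rewrite rmorphD !mxE !coefD !path_coeffD u1 u2 u3 u4 v1 v2 v3 v4.
have [_ [h1 h2 h3 h4]] := rep_path p.
rewrite rhoZ -mulmxE mul_scalar_mx !mxE !coefCM !path_coeffZ h1 h2 h3 h4.
by rewrite !path_coeff_word.
Qed.

End Representation.

(* Every path starting at vertex 2 is trivial or begins with x or y^*. *)
Lemma decompose_pi2 (u : A) : exists c f g, u * pi2 = c *: pi2 + f * x + g * y'.
Proof.
elim/path_algebra_gen_ind: u =>
  [u v [c [f [g e1]]] [c' [f' [g' e2]]]|c u [c' [f [g e]]]|v|e u [c [f [g h]]]].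
- exists (c + c'), (f + f'), (g + g'); rewrite mulrDl e1 e2 scalerDl !mulrDl.
  by rewrite addrACA; congr (_ + _); rewrite addrACA.
- exists (c * c'), (c *: f), (c *: g).
  by rewrite -scalerAl e !scalerDr scalerA -!scalerAl.
- rewrite vertex_elt_mul; case: eqP => [->|_].
    by exists 1, 0, 0; rewrite scale1r !mul0r !addr0.
  by exists 0, 0, 0; rewrite scale0r !mul0r !addr0.
(* Among the six arrows only x and y^* start at vertex 2; the others are killed by pi2. *)
have [c' [f' [g' ee]]] : exists c f g, arrow_elt F e * pi2 = c *: pi2 + f * x + g * y'.
  rewrite -arrow_elt_source -mulrA vertex_elt_mul.
  case: e {h} => -[] /=; try by (exists 0, 0, 0; rewrite scale0r !mul0r !addr0
    (_ : (vertex1 == vertex2) = false) ?mulr0 //; apply/eqP).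
    exists 0, 1, 0; rewrite eqxx scale0r mul0r mul1r add0r addr0.
    exact: (arrow_elt_source F (inl arrow_x : arrow Q2)).
  exists 0, 0, 1; rewrite eqxx scale0r mul0r mul1r !add0r.
  exact: (arrow_elt_source F (inr arrow_y : arrow Q2)).
exists (c * c'), (arrow_elt F e * f + c *: f'), (arrow_elt F e * g + c *: g').
rewrite -mulrA h !mulrDr -scalerAr ee !scalerDr scalerA !mulrDl -!scalerAl !mulrA.
by rewrite [LHS](AC 5 (1*(4*2)*(5*3))).
Qed.

(* The two sides differ by the coefficient at s of the determinant. *)
Lemma automorphism_det_coef (phi psi : {lrmorphism A -> A}) :
  is_symplectic_aut phi psi ->
  path_coeff path_x (phi x) * path_coeff path_ay' (phi y') +
  path_coeff path_ax (phi x) * path_coeff path_y' (phi y') =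
  path_coeff path_y' (phi x) * path_coeff path_ax (phi y') +
  path_coeff path_ay' (phi x) * path_coeff path_x (phi y').
Proof.
case=> phiK psiK phiv _; have [rho [rZ rv re]] := rep_exists.
have phiM u v : phi (u * v) = phi u * phi v by exact: rmorphM.
have phiD u v : phi (u + v) = phi u + phi v by exact: raddfD.
have phiZ c u : phi (c *: u) = c *: phi u by exact: linearZ.
have psiM u v : psi (u * v) = psi u * psi v by exact: rmorphM.
have psiv v : psi (vertex_elt F v) = vertex_elt F v by rewrite -{1}phiv phiK.
(* [phi] fixes pi1, whose matrix is the projection to coordinate 0. *)
have row0 (u : A) (i : 'I_3) k : i != 0 -> rho (phi (pi1 * u)) i k = 0.
  move=> i0; rewrite phiM phiv rmorphM rv mulmx3E !mxE.
  by rewrite (negbTE i0) /= !mul0r !addr0.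
(* Apply [phi] to the decomposition of [psi z]: the pi2 term has zero row 0, and by [row0] only the
   (0,0) entries of the left factors contribute. *)
have span (z : A) : z * pi2 = z -> exists f g : {poly F}, forall k : 'I_3, k != 0 ->
    rho z 0 k = f * rho (phi x) 0 k + g * rho (phi y') 0 k.
  move=> zpi2; have [c [f [g e]]] := decompose_pi2 (psi z).
  exists (rho (phi f) 0 0), (rho (phi g) 0 0) => k k0.
  have xpi1 : x = pi1 * x by rewrite (arrow_elt_target F (inl arrow_x : arrow Q2)).
  have ypi1 : y' = pi1 * y' by rewrite (arrow_elt_target F (inr arrow_y : arrow Q2)).
  rewrite -{1}[z]psiK -{1}zpi2 psiM psiv e !phiD phiZ !phiM phiv !rmorphD rZ rv !rmorphM.
  rewrite [in LHS]mxE [X in X + _]mxE !mulmx3E.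
  have rowx (i : 'I_3) : i != 0 -> rho (phi x) i k = 0 by rewrite xpi1; apply: row0.
  have rowy (i : 'I_3) : i != 0 -> rho (phi y') i k = 0 by rewrite ypi1; apply: row0.
  rewrite (rowx 1 isT) (rowx 2 isT) (rowy 1 isT) (rowy 2 isT) /rep_vertex !mxE /=.
  by rewrite !(mul0r, mulr0, addr0, add0r).
have x0k k : rho x 0 k = (k == 1)%:R by rewrite re mxE.
have y0k k : rho y' 0 k = (k == 2)%:R by rewrite re mxE.
(* Since x and y^* are represented by basis covectors, these coefficients form a left inverse of the
   2 x 2 matrix of [phi]. *)
have [f [g fg]] := span x (arrow_elt_source F (inl arrow_x : arrow Q2)).
have [f' [g' fg']] := span y' (arrow_elt_source F (inr arrow_y : arrow Q2)).
have := fg 1 isT; have := fg 2 isT; have := fg' 1 isT; have := fg' 2 isT.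
rewrite !x0k !y0k /=.
have [] := rep_coef rZ rv re (phi x); have [] := rep_coef rZ rv re (phi y').
move: (rho (phi x) 0 1) (rho (phi x) 0 2) (rho (phi y') 0 1) (rho (phi y') 0 2).
move=> p q r s <- <- <- <- <- <- <- <- e4 e3 e2 e1.
(* Multiplicativity of the 2 x 2 determinant. *)
have det1 : (f * g' - g * f') * (p * s - q * r) = 1.
  transitivity ((f * p + g * r) * (f' * q + g' * s) - (f * q + g * s) * (f' * p + g' * r)).
    by ring.
  by rewrite -e1 -e2 -e3 -e4 mulr1 mulr0 subr0.
(* A unit of the polynomial ring over a field is constant. *)
have : (p * s - q * r)`_1 = 0.
  have : p * s - q * r \is a GRing.unit.
    by apply/unitrPr; exists (f * g' - g * f'); rewrite mulrC.
  by rewrite poly_unitE => /andP[/eqP sz _]; rewrite nth_default // sz.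
rewrite coefB !coefM !big_ord_recl !big_ord0 /= !addr0 /bump /= => /eqP.
by rewrite subr_eq0 => /eqP.
Qed.

(** The determinant relation is quadratic and holds on every filtration step, so its differential
    kills every tangent vector at the identity; on this derivation it would be 1. *)
Lemma hamiltonian_derivation_not_in_Lie (D : {linear A -> A}) :
  (forall e, D (arrow_elt F e) = hamiltonian_values e) -> ~ in_Lie_aut D.
Proof.
move=> De [_ [n [T [tanT DT]]]].
pose ix : arrow Q2 + arrow Q2 := inl (inl arrow_x).
pose iy : arrow Q2 + arrow Q2 := inl (inr arrow_y).
pose k0 : coord_index quiver_axy := (ix, path_x).
(* The four signed monomials of the coefficient of ['X] in the determinant of the matrix of phi. *)
pose c (i : 'I_4) : F := [:: 1; 1; -1; -1]`_i.
pose u (i : 'I_4) := nth k0 [:: (ix, path_x); (ix, path_ax); (ix, path_y'); (ix, path_ay')] i.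
pose v (i : 'I_4) := nth k0 [:: (iy, path_ay'); (iy, path_y'); (iy, path_ax); (iy, path_x)] i.
have /(zariski_tangent_quadratic tanT) : forall P' : gen_point F quiver_axy,
    aut_filtration n P' -> \sum_k c k * (gen_coord (u k) P' * gen_coord (v k) P') = 0.
  move=> P' [phi [psi [aut eqP' _]]].
  have := automorphism_det_coef aut.
  rewrite !big_ord_recl big_ord0 /gen_coord /= !eqP' /= => h.
  by rewrite !mul1r !mulN1r addr0 addrA h -opprD subrr.
rewrite !big_ord_recl big_ord0 /gen_coord /= -!DT !De /=.
have -> : a * x = path_elt F path_ax.
  rewrite path_elt_mul; case: pcompP => [w h1 h2 h3 h4|[]] //=.
  by congr path_elt; apply: qpath_inj.
rewrite !path_coeff0 /arrow_elt !(path_coeff_word F (arrow_path (inr arrow_y : arrow Q2))) //=.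
rewrite (path_coeff_elt F path_ax path_ax) !eqxx mulr0n mulr1n !(mulr0, addr0, add0r, mulr1).
by move=> /eqP; rewrite /c /= oner_eq0.
Qed.

End QuiverAXY.

Theorem mainTheorem5 (R : realType) :
  let CQbar := path_algebra R[i] (double_quiver quiver_axy) in
  (forall D : {linear CQbar -> CQbar},
     in_Lie_aut D -> is_symplectic_derivation D) /\
  (exists D : {linear CQbar -> CQbar},
     is_symplectic_derivation D /\ ~ in_Lie_aut D).
Proof.
move=> CQbar; split=> [D|]; first exact: in_Lie_aut_symplectic.
have [D [sympD De]] := hamiltonian_derivation_exists R[i].
by exists D; split=> //; apply: hamiltonian_derivation_not_in_Lie.
Qed.
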